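(* Let $X_t^\omega$ be the particle position at time $t$ in the Lévy-Lorentz gas with environment $\omega$. Assume that $\mu:=\mathbb{E}[\Delta_1]<+\infty$. There exists a real number $\kappa>0$ (not depending on $\omega$) such that the following property holds for $\mathbb{P}$-a.e. $\omega$: for all $x\in(0,1]$ $$\limsup_{t\uparrow+\infty}\frac{1}{\sqrt{xt}}\ln P\big[|X_t^\omega|>xt\big]\le-\kappa.$$
   Context: The Lévy-Lorentz gas. Environment: on a probability space $(\Omega,\mathscr{F},\mathbb{P})$ (expectation $\mathbb{E}$) let $\omega=\{\omega_r\}_{r\in\mathbb{Z}}$ be random scatterer positions on $\mathbb{R}$ in ascending order with $\omega_0:=0$, such that the distances $\Delta_r^\omega:=\omega_r-\omega_{r-1}$, $r\in\mathbb{Z}$, form a bilateral sequence of i.i.d. positive random variables; $\mu:=\mathbb{E}[\Delta_1]$. Velocities: on a probability space $(\mathcal{S},\mathfrak{S},P)$ (expectation $E$) let $V_1,V_2,\ldots$ be i.i.d. with $P[V_n=1]=P[V_n=-1]=1/2$, and let $S_n:=\sum_{k=1}^nV_k$, $S_0:=0$ (simple symmetric random walk). Collision times: $T_n^\omega:=\sum_{k=1}^n|\omega_{S_k}-\omega_{S_{k-1}}|$, $T_0^\omega:=0$. Particle position: $X_t^\omega:=\omega_{S_{n-1}}+V_n(t-T_{n-1}^\omega)$ for $t\in[T_{n-1}^\omega,T_n^\omega)$, $n\ge 1$ (for $\mathbb{P}$-a.e. $\omega$, $P$-almost surely $T_n^\omega\to+\infty$, so $X_t^\omega$ is $P$-almost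 surely defined for all $t$). Convention: $\ln 0:=-\infty$. *)

(* Defs.v *)
From HB Require Import structures.
From mathcomp Require Import all_boot all_order all_algebra.
From mathcomp Require Import all_classical all_reals all_analysis.

Set Implicit Arguments.
Unset Strict Implicit.
Unset Printing Implicit Defensive.
Import Order.TTheory GRing.Theory Num.Theory.
Import numFieldNormedType.Exports.
Local Open Scope classical_set_scope.
Local Open Scope ring_scope.

HB.instance Definition _ := isPointed.Build int 0.
HB.instance Definition _ := @isMeasurable.Build default_measure_display
  int discrete_measurable discrete_measurable0
  discrete_measurableC discrete_measurableU.

Definition mutually_independent d d' (T : measurableType d)
    (U : measurableType d') (R : realType) (P : probability T R)
    (I : choiceType) (X : I -> T -> U) : Prop :=
  forall (s : seq I) (B : I -> set U), uniq s ->
    (forall i, measurable (B i)) ->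
    P (\bigcap_(i in [set` s]) (X i @^-1` B i)) =
      (\prod_(i <- s) P (X i @^-1` B i))%E.

Definition identically_distributed d d' (T : measurableType d)
    (U : measurableType d') (R : realType) (P : probability T R)
    (I : Type) (X : I -> T -> U) : Prop :=
  forall (i j : I) (B : set U), measurable B ->
    P (X i @^-1` B) = P (X j @^-1` B).

Definition iid d d' (T : measurableType d)
    (U : measurableType d') (R : realType) (P : probability T R)
    (I : choiceType) (X : I -> T -> U) : Prop :=
  [/\ forall i, measurable_fun setT (X i),
      mutually_independent P X & identically_distributed P X].

Definition gap (R : realType) (T : Type) (omega : int -> T -> R)
    (r : int) (w : T) : R :=
  omega r w - omega (r - 1) w.

(* The velocities V_1, V_2, ... are indexed from 0: [v n] is V_(n+1). *)

Definition walk (v : nat -> int) (n : nat) : int := \sum_(k < n) v k.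

Definition collision_time (R : realType) (q : int -> R) (v : nat -> int)
    (n : nat) : R :=
  \sum_(k < n) `|q (walk v k.+1) - q (walk v k)|.

(* [n] is the number of collisions up to time [t]; it is unique if it exists.
   It exists for all [t >= 0] iff the collision times tend to infinity;
   otherwise it is set to 0, and the position has no meaning. *)
Definition position (R : realType) (q : int -> R) (v : nat -> int) (t : R) : R :=
  let n := xget 0%N [set n | collision_time q v n <= t < collision_time q v n.+1]
  in q (walk v n) + (v n)%:~R * (t - collision_time q v n).

(* Main.v *)
Require Import Defs.
From HB Require Import structures.
From mathcomp Require Import all_boot all_order all_algebra.
From mathcomp Require Import all_classical all_reals all_analysis.
From mathcomp Require Import measurable_realfun ring lra zify.
Set Implicit Arguments.
Unset Strict Implicit.
Unset Printing Implicit Defensive.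
Import Order.TTheory GRing.Theory Num.Theory.
Import numFieldNormedType.Exports.
Local Open Scope classical_set_scope.
Local Open Scope ring_scope.

(** To be at distance more than y = xt at time t, the
    particle must have crossed all the gaps on one side of the origin up to
    distance y, within time t.  The walk can do so in two ways: by escaping
    ballistically, which costs an exponential price, or by making a great many
    collisions in a short time.  The second is impossible when long gaps are
    spread densely enough, because the walk is forced to cross them again and
    again.

    Put z = 2^k and r = z^13.  Let delta be so small that a gap is at most
    delta with probability at most 2^-14.  Only a first moment is available,
    so the environment is controlled along the scales z only
    ([ae_eventually_good]): by Markov's inequality and Borel-Cantelli, almost
    surely, for all large k, the scatterers of indices r and -r are within z^14
    of the origin, and every k consecutive gaps that start between them include
    one longer than delta.

    For t large, choose k with z^14 <= xt < (2z)^14.  If |X_t| > xt, then the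
    walk has reached r or -r by time t ([position_far]).  Let it make n = k z^16
    steps.  Either it reaches r or -r within those steps, or it stays between
    them and its first n steps take time at most t.
    - A union bound over the steps and the exponential moment of the walk bound
      the former by about exp (- z^8): the distance r = z^13 is much larger
      than the square root of n <= z^17, and the exponential moment is taken at
      1/z^5.
    - Cut the n steps into z^16 blocks of k steps.  A block of k steps to the
      right crosses a gap longer than delta, so it costs time delta
      ([straight_blocks_le_travel_time]); each block is of this kind with
      probability 2^-k = 1/z, independently.  So about z^15 blocks cost delta
      each, whereas t is of order z^14 / x at most: the latter event has
      probability at most exp (C z^14 - z^15 / 2).
    Since sqrt (xt) <= 128 z^7, both bounds are far below exp (- sqrt (xt))
    ([asymptotic_bound]), which gives the theorem with kappa = 1.

    The walk is handled through [coin_mean], the average over all sequences of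
    n fair tosses, in which the moments above are computed by recursion. *)

(** * Averages over fair coin tosses *)

(** The tosses are split off at the front, so that the independence of an
    initial segment from the rest is the identity [coin_mean_cat]. *)
Fixpoint coin_mean (R : realType) (n : nat) (f : seq bool -> R) : R :=
  if n is m.+1 then
    (coin_mean m (fun u => f (true :: u)) +
     coin_mean m (fun u => f (false :: u))) / 2
  else f [::].

Lemma ler_coin_mean (R : realType) n (f g : seq bool -> R) :
  (forall u, size u = n -> f u <= g u) -> coin_mean n f <= coin_mean n g.
Proof.
elim: n f g => [|n IHn] f g fg /=; first exact: fg.
by rewrite ler_pM2r ?invr_gt0 // lerD // IHn // => u su; apply: fg; rewrite /= su.
Qed.

Lemma eq_coin_mean (R : realType) n (f g : seq bool -> R) :
  (forall u, size u = n -> f u = g u) -> coin_mean n f = coin_mean n g.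
Proof.
by move=> fg; apply/le_anti; rewrite !ler_coin_mean // => u su; rewrite fg.
Qed.

Lemma coin_meanZ (R : realType) n c (f : seq bool -> R) :
  coin_mean n (fun u => c * f u) = c * coin_mean n f.
Proof. by elim: n f => [|n IHn] f //=; rewrite !IHn -mulrDr mulrA. Qed.

Lemma coin_meanD (R : realType) n (f g : seq bool -> R) :
  coin_mean n (fun u => f u + g u) = coin_mean n f + coin_mean n g.
Proof. by elim: n f g => [|n IHn] f g //=; rewrite !IHn; field. Qed.

Lemma coin_mean_cst (R : realType) n (c : R) : coin_mean n (fun=> c) = c.
Proof. by elim: n => [|n IHn] //=; rewrite IHn; field. Qed.

Lemma coin_mean_sum (R : realType) n (I : Type) (s : seq I)
    (f : I -> seq bool -> R) :
  coin_mean n (fun u => \sum_(i <- s) f i u) =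
    \sum_(i <- s) coin_mean n (f i).
Proof.
elim: s => [|i s IHs].
  by rewrite big_nil -[RHS](coin_mean_cst n); apply: eq_coin_mean => u _; rewrite big_nil.
by rewrite big_cons -IHs -coin_meanD; apply: eq_coin_mean => u _; rewrite big_cons.
Qed.

Lemma coin_mean_cat (R : realType) m n (f : seq bool -> R) :
  coin_mean (m + n) f =
    coin_mean m (fun u => coin_mean n (fun v => f (u ++ v))).
Proof. by elim: m f => [|m IHm] f //=; rewrite !IHm. Qed.

Lemma coin_mean_take (R : realType) m n (f : seq bool -> R) : (m <= n)%N ->
  coin_mean n (fun u => f (take m u)) = coin_mean m f.
Proof.
move=> /subnKC <-; rewrite coin_mean_cat; apply: eq_coin_mean => u su.
rewrite -[RHS](coin_mean_cst (n - m)); apply: eq_coin_mean => v _.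
by rewrite -su take_size_cat.
Qed.

Definition step (b : bool) : int := if b then 1 else -1.
Definition displacement (u : seq bool) : int := \sum_(b <- u) step b.

Lemma displacement_cons b u : displacement (b :: u) = step b + displacement u.
Proof. exact: big_cons. Qed.

Lemma displacement_cat u v :
  displacement (u ++ v) = displacement u + displacement v.
Proof. exact: big_cat. Qed.

(** From exp y <= 1 / (1 - y) for y < 1, applied to l and to -l, the average is
    at most 1 / (1 - l^2), which is at most 1 + 2 l^2 when l^2 <= 1/2. *)
Lemma cosh_le (R : realType) (l : R) : l ^+ 2 <= 1 / 2 ->
  (expR l + expR (- l)) / 2 <= expR (2 * l ^+ 2).
Proof.
move=> l2.
have lt1 : -1 < l < 1 by rewrite expr2 in l2; apply/andP; split; nra.
have H (y : R) : y < 1 -> expR y <= (1 - y)^-1.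
  move=> y1; rewrite -[y]opprK expRN lef_pV2 ?posrE ?expR_gt0 ?subr_gt0 ?opprK //.
  exact: expR_ge1Dx.
case/andP: lt1 => lm1 l1.
have := H l l1; have := H (- l); rewrite ltrNl lm1 => /(_ isT) Hm Hp.
apply: (@le_trans _ _ (1 + 2 * l ^+ 2)); last exact: expR_ge1Dx.
apply: (@le_trans _ _ (1 - l ^+ 2)^-1).
  have -> : (1 - l ^+ 2)^-1 = ((1 - l)^-1 + (1 - - l)^-1) / 2.
    by field; rewrite -?expr2; apply/and3P; split;
      apply: lt0r_neq0; rewrite ?subr_gt0; nra.
  by lra.
by rewrite -div1r ler_pdivrMr; nra.
Qed.

(** The steps are independent, so the moment is the n-th power of cosh l. *)
Lemma coin_mean_displacement (R : realType) (l : R) n : l ^+ 2 <= 1 / 2 ->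
  coin_mean n (fun u => expR (l * (displacement u)%:~R)) <=
    expR (2 * l ^+ 2 * n%:R).
Proof.
move=> l2; elim: n => [|n IHn] /=.
  by rewrite /displacement big_nil mulr0 mulr0.
have E b : coin_mean n (fun u => expR (l * (displacement (b :: u))%:~R)) =
    expR (l * (step b)%:~R) * coin_mean n (fun u => expR (l * (displacement u)%:~R)).
  rewrite -coin_meanZ; apply: eq_coin_mean => u _.
  by rewrite displacement_cons rmorphD mulrDr expRD.
rewrite (E true) (E false) -mulrDl mulrAC [step true]/step [step false]/step.
rewrite mulr1z mulrN1z mulr1 mulrN1.
rewrite -[n.+1]add1n natrD mulrDr mulr1 [leRHS]expRD.
apply: ler_pM => //; rewrite ?divr_ge0 ?addr_ge0 ?expR_ge0 //.
  rewrite -[0](coin_mean_cst n); apply: ler_coin_mean => u _; exact: expR_ge0.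
exact: cosh_le.
Qed.

Fixpoint straight_blocks (k J : nat) (u : seq bool) : nat :=
  if J is J'.+1 then (all id (take k u) + straight_blocks k J' (drop k u))%N
  else 0%N.

Lemma coin_mean_all (R : realType) k (a c : R) :
  coin_mean k (fun u => if all id u then a else c) = c - (c - a) / 2 ^+ k.
Proof.
elim: k => [|k IHk] /=; first by rewrite expr0; field.
rewrite IHk coin_mean_cst exprS; field.
by rewrite expf_neq0.
Qed.

(** The count is binomial with J trials and success probability 2^-k.  Each
    trial multiplies the mean by 1 - 2^-k (1 - 1/e), and 1 - 1/e >= 1/2. *)
Lemma coin_mean_straight (R : realType) k J :
  coin_mean (J * k) (fun u => expR (- (straight_blocks k J u)%:R)) <=
    expR (- (J%:R / 2 ^+ k / 2)) :> R.
Proof.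
elim: J => [|J IHJ]; first by rewrite !mul0r.
rewrite mulSn coin_mean_cat.
rewrite (@eq_coin_mean _ _ _ (fun u => (if all id u then expR (-1) else 1) *
    coin_mean (J * k) (fun v => expR (- (straight_blocks k J v)%:R)))); last first.
  move=> u su; rewrite -coin_meanZ; apply: eq_coin_mean => v _ /=.
  rewrite -su take_size_cat // drop_size_cat // natrD opprD expRD; congr (_ * _).
  by case: all; rewrite // oppr0 expR0.
have -> : - (J.+1%:R / 2 ^+ k / 2) =
    - (J%:R / 2 ^+ k / 2) + - ((2 ^+ k)^-1 / 2) :> R.
  by rewrite -[J.+1]addn1 natrD; ring.
rewrite expRD; under eq_coin_mean do rewrite mulrC.
rewrite coin_meanZ coin_mean_all.
apply: ler_pM => //.
- rewrite -[0](coin_mean_cst (J * k)); apply: ler_coin_mean => u _; exact: expR_ge0.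
- have : expR (-1) > 0 :> R by exact: expR_gt0.
  have : (2 ^+ k)^-1 <= 1 :> R by rewrite invf_le1 ?exprn_ege1 ?exprn_gt0 // ler1n.
  have : (2 ^+ k)^-1 >= 0 :> R by rewrite invr_ge0 exprn_ge0.
  nra.
- have e1 : expR (-1) <= 1 / 2 :> R.
    rewrite expRN div1r lef_pV2 ?posrE ?expR_gt0 //.
    by have := expR_ge1Dx (1 : R); lra.
  apply: le_trans (expR_ge1Dx _).
  have : (2 ^+ k)^-1 >= 0 :> R by rewrite invr_ge0 exprn_ge0.
  by nra.
Qed.

(** * Events of the velocity process *)

(** Countably many values of each coordinate make every event that concerns
    finitely many of them a countable union of cylinders, whatever [G] is. *)
Lemma measurable_prefix_event d (T : measurableType d) (V : nat -> T -> int)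
    (n : nat) (G : set (seq int)) :
  (forall i, measurable_fun setT (V i)) ->
  measurable [set s | G (mkseq (V^~ s) n)].
Proof.
move=> mV; elim: n G => [|n IHn] G.
  rewrite /mkseq /=; have [G0|nG0] := pselect (G [::]).
    rewrite (_ : mkset _ = setT); first exact: measurableT.
    by apply/seteqP; split.
  rewrite (_ : mkset _ = set0); first exact: measurable0.
  by apply/seteqP; split.
rewrite (_ : mkset _ = \bigcup_(z : int)
    (V n @^-1` [set z] `&` [set s | G (rcons (mkseq (V^~ s) n) z)])); last first.
  apply/seteqP; split => s /=; rewrite mkseqS; first by move=> Gs; exists (V n s).
  by move=> [z _ [/= -> ]].
apply: countable_bigcupT_measurable => // z; apply: measurableI.
  by rewrite -[X in measurable X]setTI; apply: mV.
exact: (IHn [set u | G (rcons u z)]).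
Qed.

Lemma measurable_finite_horizon d (T : measurableType d) (V : nat -> T -> int)
    (n : nat) (G : set (nat -> int)) :
  (forall i, measurable_fun setT (V i)) ->
  (forall v v', (forall i, (i < n)%N -> v i = v' i) -> G v -> G v') ->
  measurable [set s | G (V^~ s)].
Proof.
move=> mV Gn; rewrite (_ : mkset _ = [set s | (G \o nth 0) (mkseq (V^~ s) n)]).
  exact: measurable_prefix_event.
by apply/seteqP; split => s /=; apply: Gn => i lin; rewrite nth_mkseq.
Qed.

(** Reading any velocity other than 1 as tails makes the tosses exactly fair on
    the whole space, also where a velocity is neither 1 nor -1. *)
Definition heads (S : Type) (V : nat -> S -> int) (s : S) (i : nat) : bool :=
  V i s == 1.

Section FairCoins.
Context (R : realType) (d : measure_display) (S : measurableType d)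
  (P : probability S R) (V : nat -> {RV P >-> int}).
Hypothesis V_indep : mutually_independent P V.
Hypothesis V_p1 : forall n, P [set s | V n s = 1] = (2^-1)%:E.

Let mV i : measurable_fun setT (V i).
Proof. exact: measurable_funPT. Qed.

Lemma measurable_heads_event n (A : pred (seq bool)) :
  measurable [set s | A (mkseq (heads V s) n)].
Proof.
rewrite (_ : mkset _ = [set s | A (map (eq_op^~ 1)
    (mkseq ((fun i => V i : S -> int)^~ s) n))]).
  exact: (@measurable_prefix_event _ _ (fun i => V i) n [set u | A (map (eq_op^~ 1) u)]).
by apply/seteqP; split => s /=; rewrite -map_comp.
Qed.

Lemma probability_cylinder (u : seq bool) :
  P [set s | mkseq (heads V s) (size u) == u] = ((2 ^+ size u)^-1)%:E.
Proof.
pose B i : set int := if nth true u i then [set 1] else ~` [set 1].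
have := V_indep (s := iota 0 (size u)) (B := B) (iota_uniq _ _) (fun=> I).
have -> : \bigcap_(i in [set` iota 0 (size u)]) (V i @^-1` B i) =
    [set s | mkseq (heads V s) (size u) == u].
  apply/seteqP; split => s /=.
    move=> Bs; apply/eqP/(@eq_from_nth _ true); rewrite size_mkseq // => i iu.
    rewrite nth_mkseq // /heads; have /Bs : i \in iota 0 (size u) by rewrite mem_iota.
    by rewrite /B /=; case: nth => [/= ->|/= /eqP/negbTE]; rewrite ?eqxx.
  move=> /eqP su i /=; rewrite mem_iota /= add0n => iu.
  rewrite /B -su nth_mkseq // /heads; case: ifPn => /eqP //.
move=> ->.
rewrite (eq_bigr (fun=> (2^-1)%:E)); last first.
  move=> i _; rewrite /B; case: nth; first exact: V_p1.
  rewrite -preimage_setC probability_setC; last first.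
    by rewrite -[X in measurable X]setTI; apply: mV.
  by rewrite V_p1 -EFinB; congr EFin; field.
by rewrite -exprVn -[in RHS](size_iota 0 (size u)); elim: iota => [|i s IHs];
  rewrite ?big_nil ?big_cons // IHs -EFinM -exprS.
Qed.

(** Proved with the first tosses prescribed: revealing one more toss splits an
    event into two, which is the recursion of [coin_mean]. *)
Lemma probability_heads n (A : pred (seq bool)) :
  P [set s | A (mkseq (heads V s) n)] =
    (coin_mean n (fun u => (A u)%:R))%:E.
Proof.
suff H u : P [set s | (mkseq (heads V s) (size u) == u) &&
    A (mkseq (heads V s) (size u + n)%N)] =
    ((2 ^+ size u)^-1 * coin_mean n (fun v => (A (u ++ v))%:R))%:E.
  by have := H [::]; rewrite /= expr0 invr1 mul1r.
elim: n u => [|n IHn] u /=.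
  rewrite cats0 addn0; case Au: (A u).
    rewrite mulr1 -probability_cylinder; congr (P _); apply/seteqP; split => s /=.
      by case/andP.
    by move=> /eqP ->; rewrite eqxx Au.
  rewrite mulr0 (_ : mkset _ = set0) ?measure0 //.
  by apply/seteqP; split => // s /= /andP[/eqP ->]; rewrite Au.
pose E b := [set s | (mkseq (heads V s) (size (rcons u b)) == rcons u b) &&
    A (mkseq (heads V s) (size (rcons u b) + n)%N)].
rewrite (_ : mkset _ = E true `|` E false); last first.
  have EE b s : E b s <-> heads V s (size u) = b /\ (mkseq (heads V s) (size u) == u) &&
    A (mkseq (heads V s) (size u + n.+1)%N).
    rewrite /E /= size_rcons mkseqS addSnnS eqseq_rcons andbAC; split.
      by move=> /andP[-> /eqP].
    by case=> -> ->; rewrite eqxx.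
  apply/seteqP; split => s /=; rewrite !EE; last by case=> -[].
  by case: heads; [left|right].
have mE b : measurable (E b).
  have := measurable_heads_event (size (rcons u b) + n)
    (fun w => (take (size (rcons u b)) w == rcons u b) && A w).
  by under eq_set => s do rewrite -map_take take_iota (minn_idPl (leq_addr _ _)).
have -> : P (E true `|` E false) = (P (E true) + P (E false))%E.
  apply: measureU => //.
  apply/seteqP; split => // s [] /andP[/eqP Et _] /andP[/eqP].
  by rewrite size_rcons in Et *; rewrite size_rcons Et => /rcons_inj[].
rewrite !IHn -EFinD !size_rcons exprS; congr EFin.
have EB b : coin_mean n (fun v => (A (rcons u b ++ v))%:R : R) =
    coin_mean n (fun v => (A (u ++ b :: v))%:R).
  by apply: eq_coin_mean => v _; rewrite cat_rcons.
by rewrite (EB true) (EB false) invfM; field; rewrite expf_neq0.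
Qed.
End FairCoins.

(** * Travel times and the collision dynamics *)

Fixpoint travel_time (R : realType) (q : int -> R) (i : int) (u : seq bool) : R :=
  if u is b :: u' then `|q (i + step b) - q i| + travel_time q (i + step b) u'
  else 0.

Lemma travel_time_cat (R : realType) (q : int -> R) i u v :
  travel_time q i (u ++ v) =
    travel_time q i u + travel_time q (i + displacement u) v.
Proof.
elim: u i => [|b u IHu] i /=; first by rewrite /displacement big_nil addr0 add0r.
by rewrite IHu displacement_cons !addrA.
Qed.

Lemma distance_le_travel_time (R : realType) (q : int -> R) i u :
  `|q (i + displacement u) - q i| <= travel_time q i u.
Proof.
elim: u i => [|b u IHu] i /=.
  by rewrite /displacement big_nil addr0 subrr normr0.
rewrite displacement_cons addrA.
apply: le_trans (ler_distD (q (i + step b)) _ _) _.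
by rewrite [leLHS]addrC lerD.
Qed.

Lemma displacement_all_true u : all id u -> displacement u = (size u)%:Z.
Proof.
elim: u => [|b u IHu] /=; first by rewrite /displacement big_nil.
by case: b => //= /IHu; rewrite displacement_cons => ->.
Qed.

(** As long as the walk stays in the region where every k consecutive gaps
    include one longer than [delta], each straight block crosses such a gap. *)
Lemma straight_blocks_le_travel_time (R : realType) (q : int -> R) (delta : R)
    (r k J : nat) (i : int) (u : seq bool) :
  {homo q : i j / i <= j} ->
  (forall i : int, `|i| < r -> exists2 j, (j < k)%N &
     delta < q (i + j.+1%:Z) - q (i + j%:Z)) ->
  size u = (J * k)%N ->
  (forall m, (m <= size u)%N -> `|i + displacement (take m u)| < r) ->
  delta * (straight_blocks k J u)%:R <= travel_time q i u.
Proof.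
move=> qle long; elim: J i u => [|J IHJ] i u su bu /=.
  by rewrite mulr0; apply: le_trans (distance_le_travel_time _ _ _).
have ku : (k <= size u)%N by rewrite su mulSn leq_addr.
have stk : size (take k u) = k by rewrite size_takel.
rewrite natrD mulrDr -[X in travel_time q i X](cat_take_drop k u).
rewrite travel_time_cat; apply: lerD; last first.
  apply: IHJ => [|m]; first by rewrite size_drop su mulSn addKn.
  rewrite size_drop => mle; rewrite -addrA -displacement_cat -takeD.
  by apply: bu; rewrite -leq_subRL.
have [at_|_] := boolP (all id (take k u)); rewrite /= ?mulr1 ?mulr0; last first.
  by apply: le_trans (distance_le_travel_time _ _ _).
have ir : `|i| < r.
  by have := bu 0%N isT; rewrite take0 /displacement big_nil addr0.
have [j jk dj] := long i ir.
apply: le_trans (distance_le_travel_time _ _ _).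
rewrite displacement_all_true // stk.
apply: le_trans (ler_norm _); apply: le_trans (ltW dj) _.
by apply: lerB; apply: qle; rewrite ?lerD2l ?lez_nat // lerDl.
Qed.

Lemma walk_steps (v : nat -> int) (b : nat -> bool) (m : nat) :
  (forall i, v i = step (b i)) -> walk v m = displacement (mkseq b m).
Proof.
move=> vb; rewrite /walk /displacement big_map -(big_mkord xpredT v).
by rewrite /index_iota subn0; apply: eq_bigr.
Qed.

Lemma collision_time_steps (R : realType) (q : int -> R) (v : nat -> int)
    (b : nat -> bool) (m : nat) :
  (forall i, v i = step (b i)) ->
  collision_time q v m = travel_time q 0 (mkseq b m).
Proof.
move=> vb; elim: m => [|m IHm]; first by rewrite /collision_time big_ord0.
rewrite mkseqS -cats1 travel_time_cat -IHm -(walk_steps m vb) add0r.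
rewrite [LHS]big_ord_recr /= addr0; congr (_ + `|q _ - _|).
by rewrite [LHS]big_ord_recr /= vb.
Qed.

Lemma collision_time_le (R : realType) (q : int -> R) (v : nat -> int) m n :
  (m <= n)%N -> collision_time q v m <= collision_time q v n.
Proof.
move=> /subnKC <-; elim: (n - m)%N => [|p IHp]; first by rewrite addn0.
by rewrite addnS (le_trans IHp) // [leRHS]big_ord_recr /= lerDl.
Qed.

(** At time t the particle lies between two consecutive collision points and has
    not yet reached the second, so a particle beyond [y] starts its current
    flight at an index of absolute value at least [r].  If this flight comes
    after the n-th collision, or if infinitely many collisions happen before t,
    then the n-th collision occurs by time t. *)
Lemma position_far (R : realType) (q : int -> R) (v : nat -> int) (t y : R)
    (r n : nat) :
  {mono q : i j / i <= j} -> q 0 = 0 -> 0 <= t ->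
  (forall i, v i = 1 \/ v i = -1) ->
  q r%:Z <= y -> - y <= q (- r%:Z) -> y < `|position q v t| ->
  (exists2 m, (m <= n)%N & (r%:Z <= `|walk v m|)) \/ collision_time q v n <= t.
Proof.
move=> qle q0 t0 v1 qr qNr.
have qlt := leW_mono qle.
have [[m0 tm0]|noidx] := pselect (exists m,
    collision_time q v m <= t < collision_time q v m.+1).
  have := xgetPex 0%N (ex_intro
    [set k | collision_time q v k <= t < collision_time q v k.+1] m0 tm0).
  rewrite /position; set m := xget _ _ => /=.
  case/andP=> Tm TSm yX.
  have [nm|mn] := ltnP n m.
    by right; apply: le_trans Tm; apply: collision_time_le; exact: ltnW.
  left; exists m => //.
  have : walk v m.+1 = walk v m + v m by rewrite /walk big_ord_recr.
  move: TSm; rewrite /collision_time big_ord_recr /= -/(collision_time q v m) => TSm WS.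
  move: TSm yX; rewrite WS => TSm.
  rewrite lter_normr => /orP[] yX.
    have [vm|vm] := v1 m; rewrite vm in TSm yX.
      have lt : q r < q (walk v m + 1).
        have := qlt (walk v m) (walk v m + 1); rewrite ltrDl ltr01 => qS.
        rewrite gtr0_norm ?subr_gt0 // in TSm.
        by apply: le_lt_trans qr _; rewrite mulr1z mul1r in yX; lra.
      by rewrite qlt in lt; apply: le_trans (ler_norm _); rewrite -ltzD1.
    have lt : q r < q (walk v m).
      by rewrite mulrN1z mulN1r in yX; apply: le_lt_trans qr _; lra.
    by rewrite qlt in lt; apply: le_trans (ler_norm _); apply: ltW.
  have [vm|vm] := v1 m; rewrite vm in TSm yX.
    have lt : q (walk v m) < q (- r%:Z).
      by rewrite mulr1z mul1r in yX; apply: lt_le_trans qNr; lra.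
    rewrite qlt in lt; rewrite -normrN; apply: le_trans (ler_norm _).
    by rewrite lerNr ltW.
  have lt : q (walk v m - 1) < q (- r%:Z).
    have := qlt (walk v m - 1) (walk v m); rewrite gtrBl ltr01 => qS.
    rewrite ltr0_norm ?subr_lt0 // in TSm.
    by apply: lt_le_trans qNr; rewrite mulrN1z mulN1r in yX; lra.
  rewrite qlt in lt; rewrite -normrN; apply: le_trans (ler_norm _).
  by rewrite lerNr -ltzD1 -ltrBlDr.
move=> _; right; elim: n => [|n IHn]; first by rewrite /collision_time big_ord0.
by rewrite leNgt; apply/negP => tn; apply: noidx; exists n; rewrite IHn.
Qed.

(** * The confinement estimate in a fixed environment *)

Lemma eq_walk (v v' : nat -> int) n :
  (forall i, (i < n)%N -> v i = v' i) -> walk v n = walk v' n.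
Proof. by move=> vv'; apply: eq_bigr => i _; rewrite vv'. Qed.

Lemma eq_collision_time (R : realType) (q : int -> R) (v v' : nat -> int) n :
  (forall i, (i < n)%N -> v i = v' i) ->
  collision_time q v n = collision_time q v' n.
Proof.
move=> vv'; apply: eq_bigr => i _; congr (`|q _ - q _|); apply: eq_walk => j ji.
  by apply: vv'; apply: leq_trans ji _.
by apply: vv'; apply: ltn_trans ji _.
Qed.

(** The index selected in [position] is unique when it exists, which makes the
    event a countable combination of events on finitely many velocities. *)
Lemma measurable_position (R : realType) d (T : measurableType d)
    (V : nat -> T -> int) (q : int -> R) (t y : R) :
  (forall i, measurable_fun setT (V i)) ->
  measurable [set s | y < `|position q (V^~ s) t|].
Proof.
move=> mV.
pose idx n (v : nat -> int) := collision_time q v n <= t < collision_time q v n.+1.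
pose pos n (v : nat -> int) := q (walk v n) + (v n)%:~R * (t - collision_time q v n).
have idx_uniq v m n : idx m v -> idx n v -> m = n.
  move=> /andP[m1 m2] /andP[n1 n2]; apply/eqP; rewrite eqn_leq.
  by apply/andP; split; rewrite leqNgt; apply/negP => /(@collision_time_le _ q v);
    rewrite leNgt => /negP; apply; [apply: le_lt_trans m1 n2|apply: le_lt_trans n1 m2].
have posE n v : idx n v -> position q v t = pos n v.
  by move=> nv; rewrite /position (@xget_unique _ 0%N _ n) // => m /= /idx_uniq; apply.
have posN v : (forall n, ~ idx n v) -> position q v t = pos 0%N v.
  by move=> nv; rewrite /position xgetPN.
rewrite (_ : mkset _ = \bigcup_n [set s | idx n (V^~ s) /\ y < `|pos n (V^~ s)| ] `|`
    ((\bigcap_n [set s | ~ idx n (V^~ s)]) `&` [set s | y < `|pos 0%N (V^~ s)| ])); last first.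
  apply/seteqP; split => s /=.
    have [[n nv]|nv] := pselect (exists n, idx n (V^~ s)).
      by rewrite (posE n) // => yp; left; exists n.
    have nv' n : ~ idx n (V^~ s) by move=> ?; apply: nv; exists n.
    by rewrite (posN _ nv') => yp; right; split => // n _; apply: nv'.
  move=> [[n _ /= [nv]]|[nv]]; first by rewrite -(posE n).
  by rewrite -posN // => n; apply: nv.
have eq_idx n v v' : (forall i, (i < n.+1)%N -> v i = v' i) -> idx n v -> idx n v'.
  move=> vv'; rewrite /idx (@eq_collision_time _ _ v v') ?(@eq_collision_time _ _ v v' n.+1) //.
  by move=> i ni; apply: vv'; apply: ltnW.
have eq_pos n v v' : (forall i, (i < n.+1)%N -> v i = v' i) -> pos n v = pos n v'.
  move=> vv'; rewrite /pos vv' // (@eq_collision_time _ _ v v') ?(@eq_walk v v') //;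
  by move=> i ni; apply: vv'; apply: ltnW.
apply: measurableU; first apply: bigcup_measurable => n _.
  apply: (@measurable_finite_horizon _ _ V n.+1
    [set v | idx n v /\ y < `|pos n v| ]) => // v v' vv' /= [i1 i2].
  by rewrite -(eq_pos _ _ _ vv'); split => //; apply: eq_idx i1.
apply: measurableI; first apply: bigcap_measurable => // n _.
  apply: (@measurable_finite_horizon _ _ V n.+1 [set v | ~ idx n v]) => // v v' vv' /= i1 i2.
  by apply: i1; apply: eq_idx i2 => i ni; rewrite vv'.
apply: (@measurable_finite_horizon _ _ V 1 [set v | y < `|pos 0%N v| ]) => // v v' vv' /=.
by rewrite -(eq_pos _ _ _ vv').
Qed.

Section Quenched.
Context (R : realType) (d : measure_display) (S : measurableType d)
  (P : probability S R) (V : nat -> {RV P >-> int}).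
Hypothesis V_indep : mutually_independent P V.
Hypothesis V_p1 : forall n, P [set s | V n s = 1] = (2^-1)%:E.
Hypothesis V_m1 : forall n, P [set s | V n s = -1] = (2^-1)%:E.

Lemma ae_velocity : {ae P, forall s, forall n, V n s = 1 \/ V n s = -1}.
Proof.
apply/ae_foralln => n.
pose A := [set s | V n s = 1] `|` [set s | V n s = -1].
have mB z : measurable [set s | V n s = z].
  have mV : measurable_fun setT (V n) by exact: measurable_funPT.
  by have := mV measurableT [set z] Logic.I; rewrite setTI.
have mA : measurable A by apply: measurableU.
have PA : P (~` A) = 0.
  have PA : P A = 1%E.
    rewrite (_ : 1%E = ((2^-1)%:E + (2^-1)%:E)%E); last first.
      by rewrite -EFinD; congr EFin; field.
    rewrite -{1}(V_p1 n) -(V_m1 n); apply: measureU => //.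
    by apply/seteqP; split => // s [/= -> /eqP].
  by rewrite probability_setC // PA subee.
by exists (~` A); split; [exact: measurableC|exact: PA|move=> s].
Qed.

(** The Chernoff majorant of the event that the walk reaches distance [r] within
    J * k steps or else makes these steps in time at most t: one exponential
    for each step and each side, and one for the straight blocks, of which at
    most t / delta fit in time t. *)
Definition escape_or_fast_bound (delta l t : R) (r k J : nat) (u : seq bool) : R :=
  \sum_(m < (J * k).+1)
     (expR (l * (displacement (take m u))%:~R) +
      expR (- l * (displacement (take m u))%:~R)) * expR (- (l * r%:R)) +
  expR (t / delta) * expR (- (straight_blocks k J u)%:R).

(** The two terms are the two ways of being far at time t: escaping within
    J * k steps, and making J * k steps by time t. *)
Lemma quenched_bound (q : int -> R) (delta l t y : R) (r k J : nat) :
  {mono q : i j / i <= j} -> q 0 = 0 -> 0 <= t -> 0 < delta ->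
  q r%:Z <= y -> - y <= q (- r%:Z) ->
  (forall i : int, `|i| < r -> exists2 j, (j < k)%N &
     delta < q (i + j.+1%:Z) - q (i + j%:Z)) ->
  0 <= l -> l ^+ 2 <= 1 / 2 ->
  (P [set s | y < `|position q (fun n => V n s) t|]%R <=
   ((J * k).+1%:R * 2 * expR (2 * l ^+ 2 * (J * k)%:R - l * r%:R) +
     expR (t / delta - J%:R / 2 ^+ k / 2))%:E)%E.
Proof.
move=> qle q0 t0 d0 qr qNr long l0 l2.
set n0 := (J * k)%N.
pose A u := [exists m : 'I_n0.+1, r%:Z <= `|displacement (take m u)|] ||
  (travel_time q 0 u <= t).
apply: (@le_trans _ _ (P [set s | A (mkseq (heads (fun n => V n : S -> int) s) n0)])).
  have [N [mN N0 subN]] := ae_velocity.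
  rewrite -[leRHS]adde0 -N0.
  apply: le_trans (measureU2 _ _ _); last 2 first.
  - exact: (@measurable_heads_event _ _ _ P V).
  - by [].
  apply: le_measure; rewrite ?inE.
  - by apply: (@measurable_position _ _ _ (fun n => V n)) => i; exact: measurable_funPT.
  - by apply: measurableU => //; exact: (@measurable_heads_event _ _ _ P V).
  move=> s /= yX; have [v1|] := pselect (forall n, V n s = 1 \/ V n s = -1); last first.
    by move=> v1; right; apply: subN.
  left; rewrite /A.
  have vb i : V i s = step (heads (fun n => V n : S -> int) s i).
    by rewrite /heads; case: (v1 i) => ->.
  have [[m mn rm]|Tn] := position_far n0 qle q0 t0 v1 qr qNr yX.
    apply/orP; left; apply/existsP; exists (Ordinal (mn : (m < n0.+1)%N)) => /=.
    by rewrite -map_take take_iota (minn_idPl mn) -(walk_steps m vb).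
  by apply/orP; right; rewrite -(collision_time_steps q n0 vb).
rewrite probability_heads // lee_fin.
apply: (@le_trans _ _ (coin_mean n0 (escape_or_fast_bound delta l t r k J))).
  apply: ler_coin_mean => u su; rewrite /escape_or_fast_bound -/n0.
  set s1 := \sum_(_ < _) _; set s2 := _ * expR _.
  have s10 : 0 <= s1.
    by apply: sumr_ge0 => m _; rewrite mulr_ge0 ?addr_ge0 ?expR_ge0.
  have s20 : 0 <= s2 by rewrite mulr_ge0 ?expR_ge0.
  rewrite /A; case: existsP => [[m rm]|far] /=.
    rewrite -[leLHS]addr0; apply: lerD => //.
    rewrite /s1 (bigD1 m) //= -[leLHS]addr0; apply: lerD; last first.
      by apply: sumr_ge0 => m' _; rewrite mulr_ge0 ?addr_ge0 ?expR_ge0.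
    set D := displacement _ in rm *.
    have rD : r%:R <= `|D%:~R| :> R.
      by rewrite -intr_norm (_ : r%:R = r%:Z%:~R) // ler_int.
    have pos1 (a : R) : 0 <= a -> true%:R <= expR a by move=> a0; rewrite -expR0 ler_expR.
    rewrite mulrDl -!expRD.
    move: rD; rewrite ler_normr => /orP[] rD.
      rewrite -[leLHS]addr0; apply: lerD; last exact: expR_ge0.
      by apply: pos1; rewrite subr_ge0 ler_wpM2l.
    rewrite -[leLHS]add0r; apply: lerD; first exact: expR_ge0.
    by apply: pos1; rewrite subr_ge0 mulNr -mulrN ler_wpM2l.
  case: (lerP _ t) => [Tt|_] /=; last by rewrite addr_ge0.
  rewrite -[leLHS]add0r; apply: lerD => //.
  rewrite /s2 -expRD -{1}expR0 ler_expR subr_ge0 ler_pdivlMr // mulrC.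
  apply: le_trans Tt; apply: (@straight_blocks_le_travel_time _ _ _ r) => //.
    by move=> i j ij; rewrite qle.
  move=> m; rewrite su => mn; rewrite add0r ltNge; apply/negP => rm.
  by apply: far; exists (Ordinal (mn : (m < n0.+1)%N)).
rewrite coin_meanD; apply: lerD; last first.
  by rewrite coin_meanZ [leRHS]expRD ler_wpM2l ?expR_ge0 // coin_mean_straight.
rewrite coin_mean_sum.
apply: (@le_trans _ _ (\sum_(m < n0.+1)
    (2 * expR (2 * l ^+ 2 * n0%:R - l * r%:R)))); last first.
  by rewrite sumr_const card_ord -[leLHS]mulr_natl mulrA.
apply: ler_sum => m _.
rewrite (@coin_mean_take _ m n0 (fun u => (expR (l * (displacement u)%:~R) +
      expR (- l * (displacement u)%:~R)) * expR (- (l * r%:R)))); last by rewrite -ltnS.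
under eq_coin_mean do rewrite mulrC.
rewrite coin_meanZ coin_meanD expRD mulrA mulrC ler_pM2r ?expR_gt0 //.
have mle : expR (2 * l ^+ 2 * m%:R) <= expR (2 * l ^+ 2 * n0%:R).
  by rewrite ler_expR ler_wpM2l ?mulr_ge0 ?sqr_ge0 // ler_nat -ltnS.
rewrite mulr_natl mulr2n; apply: lerD; apply: le_trans mle.
  exact: coin_mean_displacement.
by rewrite -sqrrN; apply: coin_mean_displacement; rewrite sqrrN.
Qed.
End Quenched.

(** * Gaps of the random environment *)

(** Both integrals are taken against the common image measure; the absolute
    value only provides a function that is nonnegative on the whole line. *)
Lemma identically_distributed_integral (R : realType) d (T : measurableType d)
    (P : probability T R) (I : Type) (X : I -> T -> R) :
  (forall i, measurable_fun setT (X i)) -> (forall i w, 0 <= X i w) ->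
  identically_distributed P X ->
  forall i j, (\int[P]_w (X i w)%:E = \int[P]_w (X j w)%:E)%E.
Proof.
move=> mX X0 eqX i j.
have push k : (\int[P]_w (X k w)%:E =
    \int[pushforward P (X k)]_(y in setT) `|y|%:E)%E.
  rewrite ge0_integral_pushforward //=.
  - by apply: eq_integral => w _; rewrite ger0_norm.
  - by apply/measurable_EFinP; apply: normr_measurable.
rewrite !push; apply: eq_measure_integral => A mA _; exact: eqX.
Qed.

Section Environment.
Context (R : realType) (d : measure_display) (Omega : measurableType d)
  (PP : probability Omega R) (X : int -> Omega -> R).
Hypothesis X_iid : iid PP X.
Hypothesis X_gt0 : forall r w, 0 < X r w.

Let mX i : measurable_fun setT (X i).
Proof. by case: X_iid. Qed.

Lemma measurable_sum_gt (s : seq int) (c : R) :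
  measurable [set w | c <= \sum_(i <- s) X i w].
Proof.
rewrite -[X in measurable X]setTI.
by apply: measurable_fun_le => //; apply: measurable_sum.
Qed.

Lemma sum_markov (s : seq int) (c mu : R) : 0 < c ->
  ('E_PP[X 1] = mu%:E)%E ->
  (PP [set w | (c <= \sum_(i <- s) X i w)%R] <= ((size s)%:R * mu / c)%:E)%E.
Proof.
move=> c0 Emu; case: X_iid => _ _ Xid.
have EX i : (\int[PP]_w (X i w)%:E = mu%:E)%E.
  rewrite (@identically_distributed_integral _ _ _ PP _ X _ _ _ i 1) //.
    by rewrite -Emu unlock.
  by move=> k w; exact: ltW.
have Xs0 w : 0 <= \sum_(i <- s) X i w by apply: sumr_ge0 => i _; exact: ltW.
have mXs : measurable_fun setT (fun w => (\sum_(i <- s) X i w)%:E).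
  by apply/measurable_EFinP/measurable_sum.
have := @le_integral_comp_abse _ _ _ PP setT measurableT _ c id
  (@measurable_id _ _ _) (fun r r0 => r0) (fun _ _ _ _ le => le) mXs c0.
rewrite setTI.
have -> : [set x | (c%:E <= `|(\sum_(i <- s) X i x)%:E|)%E] =
    [set w | c <= \sum_(i <- s) X i w].
  by apply: eq_set => w; rewrite abse_EFin lee_fin ger0_norm.
under eq_integral => w _ do rewrite abse_EFin ger0_norm // -sumEFin.
rewrite ge0_integral_sum //; last 2 first.
- by move=> i; apply/measurable_EFinP.
- by move=> i w _; rewrite lee_fin ltW.
rewrite (eq_bigr (fun=> mu%:E)) // => H.
have sumE : (\sum_(i <- s) mu%:E = ((size s)%:R * mu)%:E)%E.
  elim: (s) => [|a u IHu]; first by rewrite big_nil mul0r.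
  by rewrite big_cons IHu -EFinD -[(size (a :: u))]/((size u).+1) -add1n natrD mulrDl mul1r.
by rewrite EFinM lee_pdivlMr // muleC -sumE.
Qed.

(** The events [X 1 <= 1/n] decrease to the empty set, since the gaps are
    positive. *)
Lemma small_gap_rare (eps : R) : 0 < eps ->
  exists2 delta : R, 0 < delta & (PP [set w | (X 1 w <= delta)%R] <= eps%:E)%E.
Proof.
move=> eps0; pose F n := [set w | X 1 w <= n.+1%:R^-1].
have mF n : measurable (F n).
  by rewrite -[X in measurable X]setTI; apply: measurable_fun_le.
have capF : \bigcap_n F n = set0.
  apply/seteqP; split => // w /= Fw.
  have [n _ /(_ n (leqnn _))] := near_infty_natSinv_lt (PosNum (X_gt0 1 w)).
  by move=> /=; rewrite ltNge (Fw n I).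
have F0 : (PP (F 0%N) < +oo)%E by rewrite (le_lt_trans (probability_le1 _ (mF _))) ?ltry.
have := @nonincreasing_cvg_mu _ _ _ PP F F0 mF.
rewrite capF => /(_ measurable0) H.
have /H : nonincreasing_seq F.
  move=> m n mn; apply/subsetPset => w; rewrite /F /= => /le_trans; apply.
  by rewrite lef_pV2 ?posrE ?ltr0Sn // ler_nat ltnS.
rewrite measure0 => /fine_cvgP[finF /cvgrPdist_le /(_ _ eps0)].
move=> /(filterI finF) [n _ /(_ n (leqnn _))] [/= fn].
rewrite sub0r normrN ger0_norm ?fine_ge0 // => Fe.
exists (n.+1%:R^-1); first by rewrite invr_gt0.
by rewrite -(fineK fn) lee_fin.
Qed.

Lemma small_gap_run (delta q : R) (i : int) (k : nat) :
  PP [set w | (X 1 w <= delta)%R] = q%:E ->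
  PP [set w | forall j, (j < k)%N -> X (i + j.+1%:Z) w <= delta] = (q ^+ k)%:E.
Proof.
move=> Eq; case: X_iid => _ Xind Xid.
have mB : measurable [set x : R | x <= delta].
  by rewrite -[X in measurable X]setTI; apply: measurable_fun_le.
have Eqi r : PP (X r @^-1` [set x | x <= delta]) = q%:E by rewrite (Xid r 1).
have := Xind [seq i + j.+1%:Z | j <- iota 0 k] (fun=> [set x | x <= delta]).
rewrite map_inj_uniq ?iota_uniq; last by move=> a b /addrI [].
move=> /(_ isT (fun=> mB)).
have -> : \bigcap_(r in [set` [seq i + j.+1%:Z | j <- iota 0 k]])
    (X r @^-1` [set x | x <= delta]) =
    [set w | forall j, (j < k)%N -> X (i + j.+1%:Z) w <= delta].
  apply/seteqP; split => w /= Xw.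
    by move=> j jk; apply: Xw => /=; apply/mapP; exists j; rewrite ?mem_iota.
  by move=> r /= /mapP[j]; rewrite mem_iota add0n => /= jk ->; exact: Xw.
move=> ->; rewrite (eq_bigr (fun=> q%:E)) // big_map.
rewrite -[in RHS](size_iota 0 k); elim: iota => [|j s IHs]; first by rewrite big_nil.
by rewrite big_cons IHs -EFinM -exprS.
Qed.

End Environment.

(** * Almost every environment is good at all large scales *)

(** With z = 2^k: the z^13 gaps on each side of the origin span at most z^14,
    and every k consecutive ones include a gap longer than [delta]. *)
Definition good_level (R : realType) (q : int -> R) (delta : R) (k : nat) : Prop :=
  [/\ q (2 ^ (13 * k))%N%:Z <= 2 ^+ (14 * k),
      - 2 ^+ (14 * k) <= q (- (2 ^ (13 * k))%N%:Z) &
      forall i : int, `|i| < (2 ^ (13 * k))%N%:Z -> exists2 j, (j < k)%N &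
        delta < q (i + j.+1%:Z) - q (i + j%:Z)].

(** Markov's inequality gives r mu / z^14 = mu / z on each side, where mu is the
    mean gap.  A window of k gaps all at most [delta] has probability at most
    2^(-14 k) = 1 / z^14, and 2 r windows start between -r and r, which gives
    2 / z.  The total is summable in k. *)
Lemma ae_eventually_good (R : realType) (d : measure_display)
    (Omega : measurableType d) (PP : probability Omega R)
    (omega : int -> Omega -> R) :
  (forall w, omega 0 w = 0) -> iid PP (gap omega) ->
  (forall r w, 0 < gap omega r w) -> ('E_PP[gap omega 1] < +oo)%E ->
  exists2 delta : R, 0 < delta &
    {ae PP, forall w, exists K, forall k, (K <= k)%N ->
       good_level (omega^~ w) delta k}.
Proof.
move=> omega0 Xiid X0 mu_fin.
have [mX _ _] := Xiid.
have [mu Emu] : exists mu, ('E_PP[gap omega 1] = mu%:E)%E.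
  exists (fine 'E_PP[gap omega 1]); rewrite fineK // ge0_fin_numE //.
  by apply: expectation_ge0 => w; exact: ltW.
have mu0 : 0 <= mu.
  by rewrite -lee_fin -Emu; apply: expectation_ge0 => w; exact: ltW.
(* (2^-14)^k against the 2 (2^13)^k starting points leaves 2 / 2^k. *)
have [|delta d0 dsmall] := small_gap_rare Xiid X0 (eps := (2 ^+ 14)^-1).
  by rewrite invr_gt0 exprn_gt0.
exists delta => //.
have mXle r : measurable [set w | gap omega r w <= delta].
  by rewrite -[X in measurable X]setTI; apply: measurable_fun_le.
have [q Eq] : exists q, PP [set w | (gap omega 1 w <= delta)%R] = q%:E.
  exists (fine (PP [set w | (gap omega 1 w <= delta)%R])).
  by rewrite fineK // fin_num_measure.
have q14 : q <= (2 ^+ 14)^-1 by rewrite -lee_fin -Eq.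
have q0 : 0 <= q by rewrite -lee_fin -Eq.
pose rt k := [seq j%:Z + 1 | j <- iota 0 (2 ^ (13 * k))].
pose lt k := [seq - j%:Z | j <- iota 0 (2 ^ (13 * k))].
have rtE n w : omega n%:Z w = \sum_(i <- [seq j%:Z + 1 | j <- iota 0 n]) gap omega i w.
  elim: n => [|n IHn]; first by rewrite big_nil omega0.
  rewrite -addn1 iotaD map_cat big_cat /= -IHn big_seq1 /gap add0n addrK.
  by rewrite PoszD subrKC.
have ltE n w : - omega (- n%:Z) w = \sum_(i <- [seq - j%:Z | j <- iota 0 n]) gap omega i w.
  elim: n => [|n IHn]; first by rewrite big_nil oppr0 omega0 oppr0.
  rewrite -addn1 iotaD map_cat big_cat /= -IHn big_seq1 /gap add0n.
  by rewrite PoszD opprD addrA addNr add0r.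
(* The windows that start in [-r, r) are numbered by 0 <= m < 2 r. *)
pose W k (m : nat) := [set w | forall j, (j < k)%N ->
  gap omega (m%:Z - (2 ^ (13 * k))%N%:Z + j.+1%:Z) w <= delta].
pose A1 k := [set w | 2 ^+ (14 * k) <= \sum_(i <- rt k) gap omega i w].
pose A2 k := [set w | 2 ^+ (14 * k) <= \sum_(i <- lt k) gap omega i w].
pose A3 k := \big[setU/set0]_(m < (2 ^ (13 * k)).*2) W k m.
have mA1 k : measurable (A1 k) by exact: (measurable_sum_gt Xiid).
have mA2 k : measurable (A2 k) by exact: (measurable_sum_gt Xiid).
have mW k m : measurable (W k m).
  rewrite (_ : W k m = \bigcap_j [set w | (j < k)%N ->
      gap omega (m%:Z - (2 ^ (13 * k))%N%:Z + j.+1%:Z) w <= delta]); last first.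
    by apply/seteqP; split => w Ww j => [_|]; apply: Ww.
  apply: bigcapT_measurable => j; have [jk|kj] := boolP (j < k)%N.
    rewrite (_ : mkset _ = [set w |
        gap omega (m%:Z - (2 ^ (13 * k))%N%:Z + j.+1%:Z) w <= delta]).
      exact: mXle.
    by apply/seteqP; split => w /=; [apply|].
  by rewrite (_ : mkset _ = setT) //; apply/seteqP; split => w //= _; rewrite (negbTE kj).
have mA3 k : measurable (A3 k) by apply: bigsetU_measurable.
pose Bad k := A1 k `|` A2 k `|` A3 k.
have mBad k : measurable (Bad k) by do 2!apply: measurableU => //.
have PBad k : (PP (Bad k) <= ((4 * mu + 4) / (2 ^ k.+1)%:R)%:E)%E.
  have p0 n : 0 < 2 ^+ n :> R by rewrite exprn_gt0.
  have two n : (2 ^+ (13 * n) / 2 ^+ (14 * n) = (2 ^+ n)^-1 :> R).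
    rewrite (_ : 14 * n = 13 * n + n)%N; last by lia.
    by rewrite exprD; field; rewrite !lt0r_neq0.
  have H12 s : size s = (2 ^ (13 * k))%N ->
      (PP [set w | (2 ^+ (14 * k) <= \sum_(i <- s) gap omega i w)%R] <=
       (mu / 2 ^+ k)%:E)%E.
    move=> ss; apply: (le_trans (sum_markov Xiid X0 _ (p0 _) Emu)).
    by rewrite ss natrX lee_fin mulrAC two mulrC.
  have H3 : (PP (A3 k) <= (2 / 2 ^+ k)%:E)%E.
    apply: (le_trans (Boole_inequality _ _)) => //.
    apply: (@le_trans _ _ (\sum_(m < (2 ^ (13 * k)).*2) ((2 ^+ (14 * k))^-1)%:E)%E).
      apply: lee_sum => m _; apply: (@le_trans _ _ (q ^+ k)%:E).
        by rewrite -(small_gap_run Xiid (m%:Z - (2 ^ (13 * k))%N%:Z) k Eq).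
      by rewrite lee_fin exprM -exprVn lerXn2r // nnegrE // invr_ge0 ltW.
    rewrite sumEFin lee_fin sumr_const card_ord -[leLHS]mulr_natl -muln2 natrM natrX.
    by rewrite mulrAC two mulrC.
  apply: le_trans (measureU2 _ _ _) _ => //; first exact: measurableU.
  apply: (@le_trans _ _ ((mu / 2 ^+ k)%:E + (mu / 2 ^+ k)%:E + (2 / 2 ^+ k)%:E)%E).
    apply: leeD => //; apply: le_trans (measureU2 _ _ _) _ => //.
    by apply: leeD; apply: H12; rewrite size_map size_iota.
  rewrite -!EFinD lee_fin natrX exprS -!mulrDl invfM mulrA ler_pM2r ?invr_gt0 //.
  lra.
have limsup0 : PP (lim_sup_set Bad) = 0.
  apply: lim_sup_set_cvg0 => //.
  apply: (@le_lt_trans _ _ (4 * mu + 4)%:E); last exact: ltry.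
  apply: le_trans (epsilon_trick0 xpredT _); last by lra.
  by apply: lee_nneseries => // k _; exact: PBad.
exists (lim_sup_set Bad); split => //.
  apply: bigcapT_measurable => n; apply: bigcup_measurable => k _; exact: mBad.
move=> w /= ngood n _; apply: contrapT => nBad; apply: ngood; exists n => k nk.
have {nBad} : ~ Bad k w by move=> Bk; apply: nBad; exists k.
move=> nB; split.
- rewrite leNgt; apply/negP => /ltW gt; apply: nB; left; left.
  by rewrite /A1 /= -rtE.
- rewrite leNgt; apply/negP; rewrite ltrNr => /ltW gt; apply: nB; left; right.
  by rewrite /A2 /= -ltE.
move=> i ir; apply: contrapT => nlong; apply: nB; right.
have im : 0 <= i + (2 ^ (13 * k))%N%:Z by move: ir; rewrite ltr_norml; lia.
rewrite /A3 -bigcup_mkord; exists (absz (i + (2 ^ (13 * k))%N%:Z)) => /=.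
  by move: ir; rewrite ltr_norml; lia.
move=> j jk; rewrite gez0_abs // addrK leNgt; apply/negP => dlt; apply: nlong.
exists j => //; move: dlt; rewrite /gap; congr (_ < _ - omega _ _).
by rewrite -addrA; congr (_ + _); lia.
Qed.

(** * Scales, asymptotics and the conclusion *)

(** Since z^17 <= exp (17 z), the polynomial factor is harmless.  Each of the
    two terms is at most half of the right-hand side. *)
Lemma asymptotic_bound (R : realType) (z C : R) : 0 <= C -> 2 * C + 400 <= z ->
  (z ^+ 17 + 1) * 2 * expR (2 * z ^+ 7 - z ^+ 8) +
    expR (C * z ^+ 14 - z ^+ 15 / 2) <= expR (- (128 * z ^+ 7)).
Proof.
move=> C0 zC.
have z400 : 400 <= z by lra.
have z0 : 0 < z by lra.
have z1 : 1 <= z by lra.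
set w := z ^+ 7.
have zw : z <= w by rewrite ler_eXnr.
have E8 : z ^+ 8 = w * z by rewrite -exprSr.
have E14 : z ^+ 14 = w * w by rewrite -exprD.
have E15 : z ^+ 15 = w * w * z by rewrite -E14 -exprSr.
suff [H1 H2] : (z ^+ 17 + 1) * 2 * expR (2 * w - z ^+ 8) <= expR (- (128 * w)) / 2 /\
    expR (C * z ^+ 14 - z ^+ 15 / 2) <= expR (- (128 * w)) / 2 by lra.
split.
  have z17 : (z ^+ 17 + 1) * 2 * 2 <= expR (17 * z + 8).
    rewrite expRD mulrC; have -> : expR (17 * z) = expR z ^+ 17 by rewrite -expRM_natl.
    have e8 : 8 <= expR 8 :> R by apply: le_trans (expR_ge1Dx _); lra.
    have ez : z ^+ 17 <= expR z ^+ 17.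
      by rewrite lerXn2r ?nnegrE ?expR_ge0 // ?(ltW z0) // (le_trans _ (expR_ge1Dx _)) //; lra.
    have z17 : 1 <= z ^+ 17 by rewrite exprn_ege1.
    by nra.
  rewrite ler_pdivlMr // mulrAC.
  apply: le_trans (ler_wpM2r (expR_ge0 _) z17) _.
  rewrite -expRD ler_expR E8; nra.
rewrite ler_pdivlMr //.
apply: (@le_trans _ _ (expR (C * z ^+ 14 - z ^+ 15 / 2) * expR 1)).
  by rewrite ler_wpM2l ?expR_ge0 // (le_trans _ (expR_ge1Dx _)).
rewrite -expRD ler_expR E14 E15.
have : w * w * (2 * C + 400) <= w * w * z by rewrite ler_wpM2l // mulr_ge0; lra.
have : w <= w * w by rewrite ler_peMr; lra.
nra.
Qed.

(** The least k with y < 2^(14 (k + 1)). *)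
Lemma dyadic_scale (R : realType) (y : R) (k0 : nat) : 2 ^+ (14 * k0) <= y ->
  exists2 k, (k0 <= k)%N & 2 ^+ (14 * k) <= y < 2 ^+ (14 * k.+1).
Proof.
move=> ky.
have p1 : 1 < 2 :> R by lra.
have ex : exists k, y < 2 ^+ (14 * k.+1).
  exists (Num.truncn y); apply: lt_le_trans (truncnS_gt y) _.
  set m := (Num.truncn y).+1; rewrite -natrX ler_nat.
  by rewrite (leq_trans (ltnW (ltn_expl m (ltnSn 1)))) // leq_exp2l // leq_pmull.
case: (ex_minnP ex) => k yk kmin; exists k.
  by have := le_lt_trans ky yk; rewrite ltr_eXn2l //; lia.
rewrite yk andbT; case: k yk kmin => [|k] yk kmin.
  by apply: le_trans ky; rewrite ler_eXn2l.
by rewrite leNgt; apply/negP => /kmin; rewrite ltnn.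
Qed.

(** When f t = 0 the logarithm is -oo and the bound is trivial. *)
Lemma limf_esup_lne_le (R : realType) (x : R) (f : R -> \bar R) (t0 : R) :
  0 < x -> (forall t, t0 <= t ->
    (0 <= f t <= (expR (- Num.sqrt (x * t)))%:E)%E) ->
  (limf_esup (fun t => ((Num.sqrt (x * t))^-1)%:E * lne (f t)) (pinfty_nbhs R)
     <= (- 1)%:E)%E.
Proof.
move=> x0 ft; set t1 := Num.max t0 1.
pose F t := (((Num.sqrt (x * t))^-1)%:E * lne (f t))%E.
apply: ereal_inf_le; exists (ereal_sup (F @` [set t | t1 < t])).
  by exists [set t | t1 < t] => //=; exists t1; split => //; exact: num_real.
apply: ge_ereal_sup => _ [t /= t1t <-].
have [t0t t_gt1] : t0 < t /\ 1 < t by move: t1t; rewrite gt_max => /andP[].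
have s0 : 0 < Num.sqrt (x * t) by rewrite sqrtr_gt0 mulr_gt0 // (lt_trans _ t_gt1).
rewrite /F; have := ft t (ltW t0t); case: (f t) => [a| |] //= /andP[a0 ale];
  last by rewrite leye_eq in ale.
rewrite !lee_fin in a0 ale; case: ifPn => [_|].
  by rewrite mulr_infty sgrV gtr0_sg // mul1e leNye.
rewrite -ltNge => agt; rewrite -EFinM lee_fin ler_pdivrMl // mulrN1.
by rewrite -(expRK (- _)) ler_ln ?posrE ?expR_gt0.
Qed.

Lemma positive_increments_mono (R : realType) (q : int -> R) :
  (forall r, 0 < q r - q (r - 1)) -> {mono q : i j / i <= j}.
Proof.
move=> q_gt0; have qS i : q i < q (i + 1).
  by have := q_gt0 (i + 1); rewrite addrK subr_gt0.
apply: le_mono => i j ij.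
have [n ->] : exists n : nat, j = i + n.+1%:Z by exists (absz (j - i)).-1; lia.
elim: n => [|n IHn]; first exact: qS.
have -> : i + n.+2%:Z = (i + n.+1%:Z) + 1 by lia.
exact: lt_trans IHn (qS _).
Qed.

Theorem theorem5 (R : realType)
    (d : measure_display) (Omega : measurableType d) (PP : probability Omega R)
    (omega : int -> {RV PP >-> R})
    (omega0 : forall w, omega 0 w = 0)
    (gap_iid : iid PP (gap omega))
    (gap_gt0 : forall r w, 0 < gap omega r w)
    (d' : measure_display) (S : measurableType d') (P : probability S R)
    (V : nat -> {RV P >-> int})
    (V_iid : iid P V)
    (V_p1 : forall n, P [set s | V n s = 1] = (2^-1)%:E)
    (V_m1 : forall n, P [set s | V n s = -1] = (2^-1)%:E)
    (mu_fin : ('E_PP[gap omega 1] < +oo)%E) :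
  exists kappa : R, 0 < kappa /\
    {ae PP, forall w : Omega, forall x : R, 0 < x <= 1 ->
      (limf_esup
         (fun t : R => ((Num.sqrt (x * t))^-1)%:E *
            lne (P [set s | x * t <
                      `|position (fun r => omega r w) (fun n => V n s) t|]%R))
         (pinfty_nbhs R)
       <= (- kappa)%:E)%E}.
Proof.
have aux (c z : R) : 0 <= c -> 2 * c + 400 <= z -> 2 <= z by lra.
exists 1; split => //.
have [delta d0 good] := ae_eventually_good omega0 gap_iid gap_gt0 mu_fin.
apply: filterS good => w [K goodK] x /andP[x0 x1].
set q := fun r => omega r w.
have qlt : {mono q : i j / i <= j}.
  by apply: positive_increments_mono => r; apply: gap_gt0.
(* In terms of z, t / delta < (2 z)^14 / (x delta) = C z^14. *)
pose C : R := 2 ^+ 14 / (x * delta).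
have C0 : 0 <= C by rewrite divr_ge0 ?exprn_ge0 // mulr_ge0 // ltW.
pose k0 := maxn K (Num.truncn (2 * C + 400)).+1.
apply: (@limf_esup_lne_le _ x _ (2 ^+ (14 * k0) / x)) => // t.
rewrite ler_pdivrMr // [t * x]mulrC => tk0; rewrite measure_ge0 /=.
have [k k0k /andP[kxt xtk]] := dyadic_scale tk0.
have [Kk Ck] : (K <= k)%N /\ ((Num.truncn (2 * C + 400)).+1 <= k)%N.
  by move: k0k; rewrite geq_max => /andP[].
have [qr qNr long] := goodK k Kk.
have xt0 : 0 <= x * t by apply: le_trans kxt; rewrite exprn_ge0.
have t0 : 0 <= t by rewrite pmulr_rge0 in xt0.
have [z zE] : exists z : R, z = 2 ^+ k by exists (2 ^+ k).
have zX n : 2 ^+ (n * k) = z ^+ n by rewrite zE mulnC exprM.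
have kz : k%:R <= z by rewrite zE -natrX ler_nat ltnW // ltn_expl.
have zC : 2 * C + 400 <= z.
  by apply: le_trans kz; apply: ltW (lt_le_trans (truncnS_gt _) _); rewrite ler_nat.
have z1 : 1 <= z by rewrite zE exprn_ege1 // ler1n.
have z0 : 0 < z by exact: lt_le_trans ltr01 z1.
have z2 : 2 <= z := aux _ _ C0 zC.
have [_ V_indep _] := V_iid.
(* At l = 1 / z^5 the gain l r = z^8 exceeds the cost 2 l^2 n <= 2 z^7. *)
apply: le_trans (@quenched_bound _ _ _ _ _ V_indep V_p1 V_m1 q delta (z ^- 5)
  t (x * t) (2 ^ (13 * k)) k (2 ^ (16 * k)) qlt (omega0 w) t0 d0 _ _ long _ _) _.
- exact: le_trans qr kxt.
- by apply: le_trans qNr; rewrite lerN2.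
- by rewrite invr_ge0 exprn_ge0 // ltW.
- have -> : z ^- 5 ^+ 2 = (z ^+ 10)^-1 by field; rewrite lt0r_neq0.
  rewrite mul1r lef_pV2 ?posrE ?exprn_gt0 //.
  by apply: le_trans z2 _; rewrite ler_eXnr.
rewrite lee_fin -natr1 natrM !natrX !zX -zE.
apply: (@le_trans _ _ (expR (- (128 * z ^+ 7)))); last first.
  rewrite ler_expR lerN2 -[leRHS]gtr0_norm ?mulr_gt0 ?exprn_gt0 // -sqrtr_sqr.
  rewrite ler_sqrt ?sqr_ge0 //; apply: le_trans (ltW xtk) _.
  by rewrite mulnS exprD zX; have -> : 2 ^+ 14 * z ^+ 14 = (128 * z ^+ 7) ^+ 2 by ring.
apply: le_trans (asymptotic_bound C0 zC); apply: lerD.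
  apply: ler_pM; [|exact: expR_ge0| |].
  - by rewrite mulr_ge0 // addr_ge0 // mulr_ge0 // exprn_ge0 // ltW.
  - by rewrite ler_pM2r // lerD2r (exprSr z 16) ler_wpM2l // exprn_ge0 // ltW.
  rewrite ler_expR; apply: lerB.
    have -> : z ^- 5 ^+ 2 = (z ^+ 10)^-1 by field; rewrite lt0r_neq0.
    rewrite -mulrA ler_pM2l // ler_pdivrMl ?exprn_gt0 //.
    by rewrite -exprD (exprSr z 16) ler_wpM2l // exprn_ge0 // ltW.
  by rewrite ler_pdivlMl ?exprn_gt0 // -exprD.
rewrite ler_expR; apply: lerB.
  rewrite ler_pdivrMr // /C -(ler_pM2l x0).
  apply: le_trans (ltW xtk) _; rewrite mulnS exprD zX.
  by rewrite le_eqVlt; apply/orP; left; apply/eqP; field; rewrite !lt0r_neq0.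
by rewrite le_eqVlt; apply/orP; left; apply/eqP; field; rewrite lt0r_neq0.
Qed.
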